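(* Let $G$ be a connected graph with $n$ vertices and minimum degree $\delta\ge 2$. Then $$pc(G)\le \max\left\{3,\frac{n-1}{\delta+1}\right\}.$$ Moreover, if $\frac{n-1}{\delta+1}>3$ and $n\ge \delta(\delta+1)+1$, then $pc(G)=\frac{n-1}{\delta+1}$ if and only if $G\cong S_r^t$, where $t-1=\delta$ and $rt+1=n$.
   Context: All graphs are finite and simple. In an edge-colored graph (adjacent edges may have the same color), a path is proper if no two adjacent edges of the path have the same color. An edge-coloring of a connected graph $G$ is a proper-path coloring if every two distinct vertices of $G$ are connected by a proper path. The proper connection number $pc(G)$ is the smallest number of colors in a proper-path coloring of $G$. For positive integers $r,t$, $rK_t$ is the disjoint union of $r$ copies of the complete graph $K_t$, and $S_r^t$ is the graph obtained from $rK_t$ by adding one extra vertex $v$ and joining $v$ to exactly one vertex of each copy of $K_t$. *)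

(* Defs.v *)
From mathcomp Require Import all_boot.

Set Implicit Arguments.
Unset Strict Implicit.
Unset Printing Implicit Defensive.

Record sgraph := SGraph {
  vertex :> finType;
  adj : rel vertex;
  adj_sym : symmetric adj;
  adj_irr : irreflexive adj }.

Definition connected (G : sgraph) : Prop :=
  forall x y : G, connect (@adj G) x y.

Definition degree (G : sgraph) (x : G) : nat := #|[set y | adj x y]|.

(* Every degree is < #|G|, so the default value #|G| of the minimum is only
   reached on the graph without vertices. *)
Definition min_degree (G : sgraph) : nat := \big[minn/#|G|]_(x : G) degree x.

Definition isomorphic (G H : sgraph) : Prop :=
  exists2 f : G -> H, bijective f & forall x y, adj (f x) (f y) = adj x y.

Section ProperConnection.

Variable G : sgraph.

(* The edge xy is the set [set x; y]; only the values of a coloring on edges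
   are ever used, the values on other sets of vertices are irrelevant. As these values must
   exist, an edgeless graph needs k > 0 here, even with no edge to color. *)
Definition edge_coloring (k : nat) := {ffun {set G} -> 'I_k}.

Definition path_colors k (c : edge_coloring k) (x : G) (p : seq G) : seq 'I_k :=
  pairmap (fun u v => c [set u; v]) x p.

(* x :: p is the sequence of vertices of the path. *)
Definition proper_path k (c : edge_coloring k) (x : G) (p : seq G) : bool :=
  [&& path (@adj G) x p, uniq (x :: p)
    & sorted (fun a b => a != b) (path_colors c x p)].

(* The bound on the length of p is no restriction, see proper_connectedP. *)
Definition proper_connected k (c : edge_coloring k) (x y : G) : bool :=
  [exists p : #|G|.-bseq G, proper_path c x p && (last x p == y)].

Lemma proper_connectedP k (c : edge_coloring k) (x y : G) :
  reflect (exists2 p : seq G, proper_path c x p & last x p = y)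
          (proper_connected c x y).
Proof.
apply: (iffP existsP) => [[p /andP[cp /eqP <-]]|[p cp <-]]; first by exists p.
have ltp : size p <= #|G|.
  by case/and3P: cp => _ /card_uniqP /= szp _; apply: ltnW; rewrite -szp max_card.
by exists (Bseq ltp); rewrite /= cp eqxx.
Qed.

Definition proper_path_coloring k (c : edge_coloring k) : bool :=
  [forall x : G, forall y : G, (x != y) ==> proper_connected c x y].

Definition proper_path_colorable (k : nat) : bool :=
  [exists c : edge_coloring k, proper_path_coloring c].

Lemma proper_path_colorable_ex :
  connected G -> exists k, proper_path_colorable k.
Proof.
move=> Gconn; exists #|{set G}|; apply/existsP.
exists [ffun A => enum_rank A]; apply/forallP => x; apply/forallP => y.
apply/implyP => _; apply/proper_connectedP.
have /connectP[p0 p0P ->] := Gconn x y.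
case/shortenP: p0P => p pP pU _; exists p => //.
apply/and3P; split=> //; rewrite /path_colors.
elim: p x pU {pP} => [|u [|v p] IHp] //= x.
case/and3P=> xU uU pU; apply/andP; split; last by apply: (IHp u); rewrite /= uU.
rewrite !ffunE (inj_eq enum_rank_inj); apply: contraNneq xU => /setP/(_ x).
by rewrite !inE eqxx /= => /esym/orP[] ->; rewrite ?orbT.
Qed.

Definition pc (Gconn : connected G) : nat :=
  ex_minn (proper_path_colorable_ex Gconn).

End ProperConnection.

Section Spider.

Variables r t : nat.

Definition rK_adj : rel ('I_r * 'I_t) :=
  fun u w => (u.1 == w.1) && (u.2 != w.2).

Lemma rK_sym : symmetric rK_adj.
Proof. by move=> u w; rewrite /rK_adj (eq_sym u.1) (eq_sym u.2). Qed.

Lemma rK_irr : irreflexive rK_adj.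
Proof. by move=> u; rewrite /rK_adj !eqxx. Qed.

Definition rK : sgraph := SGraph rK_sym rK_irr.

(* None is the extra vertex v; it is joined to the vertex of index 0 in each
   copy of K_t (so t is meant to be positive). *)
Definition S_adj : rel (option rK) := fun u w =>
  match u, w with
  | Some a, Some b => adj a b
  | None, Some b => b.2 == 0 :> nat
  | Some a, None => a.2 == 0 :> nat
  | None, None => false
  end.

Lemma S_sym : symmetric S_adj.
Proof. by case=> [a|] [b|] //=; apply: rK_sym. Qed.

Lemma S_irr : irreflexive S_adj.
Proof. by case=> [a|] //=; apply: rK_irr. Qed.

Definition S_graph : sgraph := SGraph S_sym S_irr.

End Spider.

(* Main.v *)
Require Import Defs.
From mathcomp Require Import all_boot all_order all_algebra perm zify.

Set Implicit Arguments.
Unset Strict Implicit.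
Unset Printing Implicit Defensive.

(* Let B be a set of vertices whose induced subgraph has edges oriented so as
   to connect B strongly, with 3-colored ends; give each arc the color of its
   head. Directed paths are then proper, and a path from x to y and one from y
   to x meet both x and y with different colors. A maximal such B absorbs every
   ear with ends in B, so each component of G - B is joined to B by a single
   edge, a bridge. If at most k >= 3 bridges leave B, all but three of them get
   private colors and the last three can be colored so that any two of them are
   joined by a proper path through B. Permuting colors so that they agree on
   the bridges, one extends the coloring from block to block, hence
   pc(G) <= max(3, D) where D is the largest number of bridges leaving a block.
   A bridge leads to at least delta + 1 vertices, as some vertex beyond it has
   all its neighbors there; so D (delta + 1) + |B| <= n for some block B, which
   is the bound. Equality forces |B| = 1 and branches that are complete on
   delta + 1 vertices. Conversely, the bridges at the center of a spider need
   distinct colors. *)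

(** * Blocks and ears *)

Section Blocks.

Variable G : sgraph.
Implicit Types (S B : {set G}) (u v w x y z : G) (p q : seq G).

Definition nbhd S := [set x | (x \in S) || [exists y in S, adj x y]].

Definition outer S := nbhd S :\: S.

Lemma nbhdP S x : reflect (x \in S \/ exists2 y, y \in S & adj x y) (x \in nbhd S).
Proof.
rewrite inE; apply: (iffP orP) => -[xS|]; [by left | | by left |].
  by case/exists_inP => y yS xy; right; exists y.
by case=> y yS xy; right; apply/exists_inP; exists y.
Qed.

Lemma outerP S x :
  reflect (x \notin S /\ exists2 y, y \in S & adj x y) (x \in outer S).
Proof.
rewrite inE; apply: (iffP andP) => -[xS].
  by case/nbhdP => [xS'|]; [rewrite xS' in xS | split].
by move=> h; split=> //; apply/nbhdP; right.
Qed.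

Lemma subset_nbhd S : S \subset nbhd S.
Proof. by apply/subsetP => x xS; apply/nbhdP; left. Qed.

Lemma nbhdE S x : (x \in nbhd S) = (x \in S) || (x \in outer S).
Proof.
rewrite in_setD; case: (boolP (x \in S)) => //= xS.
exact: (subsetP (subset_nbhd S)).
Qed.

Definition outside S : rel G := [rel a b | [&& adj a b, a \notin S & b \notin S]].

Lemma outside_connect_sym S : connect_sym (outside S).
Proof.
by apply: sym_connect_sym => a b; rewrite /outside /= adj_sym; case: (a \in S); case: (b \in S).
Qed.

Lemma outside_sub S S' x y :
  S \subset S' -> connect (outside S') x y -> connect (outside S) x y.
Proof.
move=> /subsetP SS'; apply: connect_sub => a b /and3P[ab aS bS]; apply: connect1.
by rewrite /outside /= ab (contra (SS' a)) ?(contra (SS' b)).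
Qed.

(* Every connected component of G - S is joined to S by at most one edge. *)
Definition bridged S := forall u v x y,
  u \in S -> v \in S -> x \notin S -> y \notin S -> adj u x -> adj v y ->
  connect (outside S) x y -> u = v /\ x = y.

Definition second_edge S (q : (G * G) * (G * G)) :=
  [&& q.1.1 \in S, q.1.2 \in S, q.2.1 \notin S & q.2.2 \notin S] &&
  [&& adj q.1.1 q.2.1, adj q.1.2 q.2.2, connect (outside S) q.2.1 q.2.2
    & (q.1.1 != q.1.2) || (q.2.1 != q.2.2)].

Lemma bridgedP S : reflect (bridged S) [forall q, ~~ second_edge S q].
Proof.
apply: (iffP forallP) => [brS u v x y uS vS xS yS ux vy xy|brS [[u v] [x y]]].
  have := brS ((u, v), (x, y)); rewrite /second_edge /= uS vS xS yS ux vy xy /=.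
  by rewrite negb_or !negbK => /andP[/eqP-> /eqP->].
apply/andP => -[/and4P[/= uS vS xS yS] /and4P[ux vy xy]].
by have [-> ->] := brS u v x y uS vS xS yS ux vy xy; rewrite !eqxx.
Qed.

(* Orienting the edge ab towards b when its color is the label of b, the
   colors met along a directed path are the labels of its vertices. *)
Definition arc (C : eqType) (c : {set G} -> C) (f : G -> C) : rel G :=
  [rel a b | [&& adj a b, c [set a; b] == f b & f a != f b]].

Definition arc_in (C : eqType) S (c : {set G} -> C) (f : G -> C) : rel G :=
  [rel a b | [&& arc c f a b, a \in S & b \in S]].

(** A strongly connected orientation in disguise: [arc_in] keeps the edges directed by [c] and [f],
    and consecutive arcs differ in color because the labels at the ends of an arc differ. *)
Definition orientable S := exists (c : {set G} -> 'I_3) (f : G -> 'I_3),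
  {in S &, forall x y, connect (arc_in S c f) x y}.

Lemma arc_antisym (C : eqType) (c : {set G} -> C) f a b : arc c f a b -> ~~ arc c f b a.
Proof.
case/and3P => _ /eqP cab fab; apply/and3P => -[_ /eqP cba _].
by rewrite -cab setUC cba eqxx in fab.
Qed.

Lemma orientable1 v : orientable [set v].
Proof.
exists (fun=> ord0), (fun=> ord0) => x y; rewrite !inE => /eqP-> /eqP->.
exact: connect0.
Qed.

Lemma third_color (a b : 'I_3) : exists z : 'I_3, (z != a) && (z != b).
Proof.
by move: a b => [[|[|[]]] // ?] [[|[|[]]] // ?];
  (by exists (inord 0); rewrite -!val_eqE /= inordK) ||
  (by exists (inord 1); rewrite -!val_eqE /= inordK) ||
  (by exists (inord 2); rewrite -!val_eqE /= inordK).
Qed.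

(* Color the vertices of the ear greedily: each has at most two colored
   neighbors when its turn comes. *)
Lemma color_ear (c : {set G} -> 'I_3) (f : G -> 'I_3) u p v :
    uniq p -> u \notin p -> v \notin p -> p != [::] -> (u != v) || (1 < size p) ->
    path (@adj G) u (rcons p v) ->
  exists (c' : {set G} -> 'I_3) (f' : G -> 'I_3),
    [/\ forall z, z \notin p -> f' z = f z,
        forall A : {set G}, (forall z, z \in p -> z \notin A) -> c' A = c A
      & path (arc c' f') u (rcons p v)].
Proof.
elim: p c f u => // x p IHp c f u /= /andP[xp p_uniq].
rewrite !inE !negb_or => /andP[ux up] /andP[vx vp] _ uv /andP[adj_ux xpv].
case: p => [|y p] in IHp xp p_uniq up vp uv xpv *.
  rewrite orbF in uv; have [z /andP[zu zv]] := third_color (f u) (f v).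
  exists (fun A => if A == [set u; x] then z else if A == [set x; v] then f v else c A).
  exists (fun a => if a == x then z else f a); split=> [a|A Ap|].
  - by rewrite inE => /negPf->.
  - have xA : x \notin A by apply: Ap; rewrite inE.
    by case: eqP => [def_A|_]; [|case: eqP => // def_A];
      rewrite def_A !inE eqxx ?orbT in xA.
  have /= /andP[adj_xv _] := xpv.
  rewrite /arc /= adj_ux adj_xv !eqxx (negPf ux) (negPf vx) (eq_sym (f u)) zu zv /=.
  (* Were [xv] the same edge as [ux], it would already carry the color [z]; [u != v] excludes
     this. *)
  case: ifP => [/eqP/setP/(_ v)|_]; last by rewrite eqxx.
  by rewrite !inE eqxx orbT (eq_sym v) (negPf uv) (negPf vx).
have [z /andP[zu _]] := third_color (f u) (f u).
have [|||c' [f' [f'E c'E c'P]]] := IHp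
    (fun A => if A == [set u; x] then z else c A)
    (fun a => if a == x then z else f a) x p_uniq xp vp.
- by [].
- by rewrite eq_sym vx.
- by [].
exists c', f'; split=> [a|A Ap|].
- by rewrite in_cons negb_or => /andP[ax ap]; rewrite f'E ?(negPf ax).
- rewrite c'E => [|a ap]; last by apply: Ap; rewrite in_cons ap orbT.
  have xA : x \notin A by apply: Ap; rewrite inE eqxx.
  by case: eqP => // def_A; rewrite def_A !inE eqxx orbT in xA.
apply/andP; split=> //; apply/and3P; split=> //.
  rewrite c'E => [|a ap]; last first.
    by rewrite !inE negb_or; apply/andP; split; apply: contraTneq ap => ->.
  by rewrite f'E // !eqxx.
by rewrite !f'E // eqxx (negPf ux) eq_sym.
Qed.

(** The ear is directed from [u] to [v], and [B] leads back from [v] to [u], so every vertex of the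
    ear lies on a closed directed walk meeting [B]. *)
Lemma orientable_ear B u p v :
    orientable B -> u \in B -> v \in B -> {in p, forall z, z \notin B} ->
    uniq p -> p != [::] -> (u != v) || (1 < size p) ->
    path (@adj G) u (rcons p v) ->
  orientable (B :|: [set z in p]).
Proof.
move=> [c [f cfP]] uB vB pB p_uniq p0 uv upv.
have notp z : z \in B -> z \notin p by apply: contraL => /pB.
have [c' [f' [f'E c'E c'P]]] :=
  color_ear c f p_uniq (notp u uB) (notp v vB) p0 uv upv.
set B' := _ :|: _; exists c', f'.
have BB' x y : x \in B -> y \in B -> connect (arc_in B' c' f') x y.
  move=> xB yB; apply: connect_sub (cfP x y xB yB) => a b.
  case/and3P => /and3P[ab cab fab] aB bB; apply: connect1.
  rewrite /arc_in /arc /= ab !f'E ?notp // fab !inE aB bB /= c'E ?cab // => z /pB.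
  by apply: contra; rewrite !inE => /orP[] /eqP->.
have pathB' : path (arc_in B' c' f') u (rcons p v).
  apply: sub_in_path (_ : all (mem B') _) c'P => [a b aB bB ab|].
    by apply/and3P.
  rewrite /= all_rcons !inE uB vB /=; apply/allP => z zp.
  by rewrite !inE zp orbT.
have to_p z : z \in p -> connect (arc_in B' c' f') u z /\ connect (arc_in B' c' f') z v.
  move=> zp; have [p1 [p2 def_p]] : exists p1 p2, p = p1 ++ z :: p2.
    by case/splitPr: zp => p1 p2; exists p1, p2.
  move: pathB'; rewrite def_p.
  rewrite -cats1 -catA /= cat_path /= => /and3P[p1P zP p2P]; split.
    apply/connectP; exists (rcons p1 z); last by rewrite last_rcons.
    by rewrite rcons_path p1P.
  by apply/connectP; exists (rcons p2 v); rewrite ?last_rcons // -cats1.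
move=> x y; rewrite !inE => xB' yB'.
have xv : connect (arc_in B' c' f') x v.
  by case/orP: xB' => [xB|/to_p[] //]; apply: BB'.
have uy : connect (arc_in B' c' f') u y.
  by case/orP: yB' => [yB|/to_p[] //]; apply: BB'.
exact: connect_trans xv (connect_trans (BB' _ _ vB uB) uy).
Qed.

(** A simple path outside [B] closes the two edges into an ear. If [u = v], then [x != y] makes it a
    cycle through [u], not one edge walked back and forth. *)
Lemma ear_of_outside B u v x y :
    u \in B -> v \in B -> x \notin B -> adj u x -> adj v y ->
    connect (outside B) x y -> (u != v) || (x != y) ->
  exists p, [/\ {in p, forall z, z \notin B}, uniq p, p != [::],
    (u != v) || (1 < size p) & path (@adj G) u (rcons p v)].
Proof.
move=> uB vB xB ux vy /connectP[p0 p0P def_y] uvxy.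
case/shortenP: p0P def_y => p pP p_uniq _ def_y; exists (x :: p); split=> //.
- move=> z; rewrite inE => /predU1P[-> //|].
  elim: p x pP {p_uniq def_y xB uvxy ux} => //= a p IHp x /andP[/and3P[_ _ aB] aP].
  by rewrite inE => /predU1P[-> //|]; apply: IHp aP.
- by case: p def_y {p_uniq pP} uvxy => [|? ?] /= => [->|_ _]; rewrite ?eqxx ?orbT ?orbF.
rewrite /= ux rcons_path -def_y adj_sym vy andbT.
by apply: sub_path pP => a b /and3P[].
Qed.

(** While some component outside [B] has a second edge into [B], there is an ear to absorb; the
    induction is on the size of the complement. *)
Lemma block_exists v : exists B, [/\ v \in B, orientable B & bridged B].
Proof.
suff: forall m B, #|~: B| <= m -> v \in B -> orientable B ->
    exists B, [/\ v \in B, orientable B & bridged B].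
  by apply; [apply: leqnn | apply: set11 | apply: orientable1].
elim=> [|m IHm] B leBm vB orB.
  exists B; split=> // a b x y _ _ xB; have: x \in ~: B by rewrite inE.
  by move: leBm; rewrite leqn0 => /eqP/cards0_eq->; rewrite inE.
have [/bridgedP brB|] := boolP [forall q, ~~ second_edge B q]; first by exists B.
case/forallPn=> -[[a b] [x y]]; rewrite negbK.
case/andP=> /and4P[/= aB bB xB yB] /and4P[ax yb xy abxy].
have [p [pB p_uniq p0 abp pP]] := ear_of_outside aB bB xB ax yb xy abxy.
apply: (IHm (B :|: [set z in p])); last exact: orientable_ear pP.
  rewrite -ltnS; apply: leq_trans leBm; apply: proper_card.
  rewrite properEneq setCS subsetUl andbT; case: p p0 pB {p_uniq abp pP} => // z p _.
  move=> /(_ z (mem_head z p)) zB; apply/eqP => /setP/(_ z).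
  by rewrite !inE eqxx orbT zB.
by rewrite inE vB.
Qed.

Lemma connect_exit (e : rel G) (A : {pred G}) x y :
    connect e x y -> x \in A -> y \notin A ->
  exists a b, [/\ a \in A, b \notin A, e a b
    & connect [rel s t | [&& e s t, s \in A & t \in A]] x a].
Proof.
case/connectP => p; elim: p x => [|z p IHp] x /= => [_ -> xA|].
  by rewrite xA.
case/andP => xz zp def_y xA yA; case: (boolP (z \in A)) => zA; last first.
  by exists x, z; split.
have [a [b [aA bA ab za]]] := IHp z zp def_y zA yA.
exists a, b; split=> //; apply: connect_trans za; apply: connect1.
by rewrite /= xz xA.
Qed.

(** If [B] met [S], directed paths inside [B] would lead from [w] into [S] and from [S] back to [w];
    both must use the bridge [uw], which has only one direction. *)
Lemma bridged_orientable_disjoint S B u w :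
    bridged S -> orientable B -> w \in B -> w \notin S -> u \in S -> adj u w ->
  [disjoint S & B].
Proof.
move=> brS [c [f cfP]] wB wS uS uw; rewrite -setI_eq0; apply/eqP/setP => s.
rewrite !inE; apply/negP => /andP[sS sB].
have wNS : w \in [predC S] by rewrite inE.
have sNS : s \notin [predC S] by rewrite inE negbK.
have [a [b [aS bS ab wa]]] := connect_exit (cfP w s wB sB) wNS sNS.
have {sNS wNS} := cfP s w sB wB.
(* Reading the path from [s] to [w] backwards lets [connect_exit] find where it last leaves [S]. *)
have -> : connect (arc_in B c f) s w =
   connect [rel x y | arc_in B c f y x] w s by rewrite connect_rev.
move/connect_exit=> /(_ [predC S]); rewrite !inE negbK => /(_ wS sS).
case=> [d [e [dS eS de wd]]]; rewrite !inE !negbK in aS bS dS eS.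
have sub x y (r : rel G) : (forall a b, r a b -> adj a b) ->
    connect [rel s t | [&& r s t, s \in [predC S] & t \in [predC S]]] x y ->
  connect (outside S) x y.
  move=> rP; apply: connect_sub => h k /and3P[hk hS kS].
  by apply: connect1; apply/and3P; split; first exact: rP.
have [ub wa'] : u = b /\ w = a.
  apply: (brS u b w a) => //; first by rewrite adj_sym; case/and3P: ab => /and3P[].
  by apply: sub wa => ? ? /and3P[/and3P[]].
have [ue wd'] : u = e /\ w = d.
  apply: (brS u e w d) => //; first by case/and3P: de => /and3P[].
  by apply: sub wd => ? ? /and3P[/and3P[]]; rewrite adj_sym.
move: ab de; rewrite -ub -wa' -ue -wd' => /and3P[ab _ _] /and3P[].
by rewrite (negPf (arc_antisym ab)).
Qed.

End Blocks.

(** * Proper paths through a block *)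

Section ColoredPaths.

Variables (G : sgraph) (C : eqType).
Implicit Types (c : {set G} -> C) (F : G -> C) (S B : {set G}).
Implicit Types (u v w x y z : G) (p q : seq G).

(** [proper_path] for colorings given as plain functions into any [eqType], so that they can be
    glued and composed with maps of colors. *)
Definition cpath c x p : bool :=
  [&& path (@adj G) x p, uniq (x :: p)
    & sorted (fun a b => a != b) (pairmap (fun u v => c [set u; v]) x p)].

(** Only the ends may lie outside [S]; this keeps paths through disjoint sets apart when they are
    concatenated. *)
Definition linked c S x y : Prop := exists p,
  [/\ cpath c x p, last x p = y & {subset x :: p <= [set x; y] :|: S}].

(** Reaching as far as [nbhd S] makes the colors of the bridges out of [S] part of the condition, so
    that a path ending on a bridge can be continued beyond it. *)
Definition good c S : Prop :=
  {in nbhd S &, forall x y, linked c S x y}.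

Lemma cpath_cons c x y p :
    adj x y -> x \notin y :: p -> cpath c y p ->
    (forall z q, p = z :: q -> c [set x; y] != c [set y; z]) ->
  cpath c x (y :: p).
Proof.
move=> xy xp /and3P[yp p_uniq colp] xyz; apply/and3P; split.
- by rewrite /= xy.
- by rewrite cons_uniq xp.
- by case: p colp xyz {xp yp p_uniq} => [|z q] //= -> /(_ z q erefl)->.
Qed.

Lemma cpath_rev c x p : cpath c x p -> cpath c (last x p) (rev (belast x p)).
Proof.
case/and3P=> xp p_uniq colp; apply/and3P; split.
- by rewrite rev_path (eq_path (e' := @adj G)) // => a b; apply: adj_sym.
- by rewrite -rev_rcons -lastI rev_uniq.
have -> : pairmap (fun u v => c [set u; v]) (last x p) (rev (belast x p))
       = rev (pairmap (fun u v => c [set u; v]) x p).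
  elim: p x {xp p_uniq colp} => //= y p IHp x.
  rewrite rev_cons -cats1 pairmap_cat IHp rev_cons -cats1 /=.
  congr (_ ++ [:: c _]); rewrite setUC; congr ([set _; _]).
  by case: p {IHp} => //= z p; rewrite rev_cons last_rcons.
by rewrite rev_sorted; apply: sub_sorted colp => a b; rewrite eq_sym.
Qed.

Lemma linked_sym c S x y : linked c S x y -> linked c S y x.
Proof.
case=> p [xp <- xpS]; exists (rev (belast x p)); split; first exact: cpath_rev.
  by case: (p) => //= z q; rewrite rev_cons last_rcons.
move=> z; rewrite -rev_rcons -lastI mem_rev => /xpS.
by rewrite (setUC [set _]).
Qed.

Lemma linked_refl c S x : linked c S x x.
Proof. by exists [::]; split=> // z; rewrite !inE => ->. Qed.

Lemma linked_edge c S x y : adj x y -> linked c S x y.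
Proof.
move=> xy; exists [:: y]; split=> // [|z]; last by rewrite !inE => ->.
apply: cpath_cons => //; rewrite inE.
by apply: contraTneq xy => ->; rewrite adj_irr.
Qed.

(** The two paths overlap in the edge from [last x p] to [y], so the color condition is already
    known at both ends of that edge. *)
Lemma cpath_cat c x p y q :
    cpath c x (rcons p y) -> cpath c (last x p) (y :: q) ->
    {in x :: p, forall z, z \notin y :: q} ->
  cpath c x (p ++ y :: q).
Proof.
case/and3P=> xpy py_uniq colpy /and3P[pyq yq_uniq colyq] disj; apply/and3P; split.
- by rewrite cat_path pyq; move: xpy; rewrite rcons_path => /andP[->].
- rewrite -cat_cons cat_uniq; apply/and3P; split.
  + by move: py_uniq; rewrite -rcons_cons rcons_uniq => /andP[].
  + by apply/hasPn => z zq; apply: contraL zq => /disj.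
  + by move: yq_uniq; rewrite cons_uniq => /andP[].
rewrite pairmap_cat /= sorted_cat_cons; apply/andP; split=> //.
by move: colpy; rewrite -cats1 pairmap_cat /= cats1.
Qed.

Lemma cpath_rcons c x p y :
    cpath c x p -> adj (last x p) y -> y \notin x :: p ->
    (forall q z, p = rcons q z -> c [set last x q; z] != c [set z; y]) ->
  cpath c x (rcons p y).
Proof.
case/lastP: p => [|p z] xp.
  move=> xy yx _; apply: cpath_cons => //.
  by rewrite inE eq_sym; rewrite inE in yx.
rewrite last_rcons => zy yp /(_ _ _ erefl) col; rewrite -cats1 cat_rcons.
case/and3P: (xp) => xpz pz_uniq _; apply: cpath_cat => //.
  have pz : adj (last x p) z by move: xpz; rewrite rcons_path => /andP[].
  have pzn : last x p != z.
    move: pz_uniq; rewrite -rcons_cons rcons_uniq => /andP[zp _].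
    by apply: contraNneq zp => <-; apply: mem_last.
  have pyn : last x p != y.
    by apply: contraNneq yp => <-; rewrite -rcons_cons mem_rcons in_cons mem_last orbT.
  apply: cpath_cons => //; first by rewrite !inE negb_or pzn.
    apply: cpath_cons => //; rewrite inE.
    by apply: contraNneq yp => <-; rewrite -rcons_cons mem_rcons in_cons eqxx.
  by move=> a q [<- _].
move=> a ap; rewrite !inE negb_or; apply/andP; split.
  move: pz_uniq; rewrite -rcons_cons rcons_uniq => /andP[zp _].
  by apply: contraNneq zp => <-.
by apply: contraNneq yp => <-; rewrite -rcons_cons mem_rcons in_cons ap orbT.
Qed.

(** Each arc has the label of its head as color, and the next arc starts at that head and ends at a
    different label. *)
Lemma directed_cpath B c F x p :
  path (arc_in B c F) x p -> uniq (x :: p) -> cpath c x p.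
Proof.
elim: p x => //= y p IHp x /andP[xy yp] /andP[xyp y_uniq].
apply: cpath_cons => //; [by case/and3P: xy => /and3P[] | exact: IHp |].
move=> z q def_p; move: yp xy; rewrite def_p /= => /andP[/and3P[yz _ _] _].
case/and3P=> /and3P[_ /eqP-> _] _ _.
by case/and3P: yz => _ /eqP->.
Qed.

Lemma directed_sub B c F x p : path (arc_in B c F) x p -> {subset p <= B}.
Proof.
elim: p x => //= y p IHp x /andP[/and3P[_ _ yB] /IHp pB] z.
by rewrite inE => /predU1P[->|/pB].
Qed.

Lemma directed_linked B c F u p :
  u \in B -> path (arc_in B c F) u p -> uniq (u :: p) -> linked c B u (last u p).
Proof.
move=> uB up p_uniq; exists p; split=> //; first exact: directed_cpath up p_uniq.
move=> z; rewrite in_cons inE => /predU1P[->|/(directed_sub up)->].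
  by rewrite uB orbT.
by rewrite orbT.
Qed.

(** The first arc is colored by the label of [head u p], so the entering edge has a single color to
    avoid, one that depends on the path. *)
Lemma enter_cpath B c F w u p :
    w \notin B -> u \in B -> adj w u -> path (arc_in B c F) u p -> uniq (u :: p) ->
    c [set w; u] != F (head u p) ->
  cpath c w (u :: p).
Proof.
move=> wB uB wu up p_uniq col; apply: cpath_cons => //.
- by apply: contra wB; rewrite in_cons => /predU1P[->|/(directed_sub up)].
- exact: directed_cpath up p_uniq.
move=> z q def_p; move: col up; rewrite def_p /= => col /andP[/and3P[uz _ _] _].
by case/and3P: uz => _ /eqP->.
Qed.

Lemma enter_linked B c F w u p :
    w \notin B -> u \in B -> adj w u -> path (arc_in B c F) u p -> uniq (u :: p) ->
    c [set w; u] != F (head u p) ->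
  linked c B w (last u p).
Proof.
move=> wB uB wu up p_uniq col; exists (u :: p).
split=> //; first exact: enter_cpath up p_uniq col.
move=> z; rewrite !inE => /or3P[->//|/eqP->|/(directed_sub up)->]; rewrite ?uB ?orbT //.
Qed.

Lemma last_arc B c F u p q z :
  path (arc_in B c F) u p -> p = rcons q z -> c [set last u q; z] = F z.
Proof.
by move=> + def_p; rewrite def_p rcons_path => /andP[_ /and3P[/and3P[_ /eqP->]]].
Qed.

(** Whatever the directed path, its last arc is colored by the label of its end, so the leaving edge
    only has to avoid that label. *)
Lemma exit_linked B c F u p w :
    u \in B -> w \notin B -> path (arc_in B c F) u p -> uniq (u :: p) ->
    adj w (last u p) -> c [set w; last u p] != F (last u p) ->
  linked c B u w.
Proof.
move=> uB wB up p_uniq wp col.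
have pB : {subset u :: p <= B}.
  by move=> z; rewrite in_cons => /predU1P[->|/(directed_sub up)].
exists (rcons p w); split; last 1 first.
- move=> z; rewrite -rcons_cons mem_rcons in_cons => /predU1P[->|/pB zB].
    by rewrite !inE eqxx orbT.
  by rewrite inE zB orbT.
- apply: cpath_rcons.
  + exact: directed_cpath up p_uniq.
  + by rewrite adj_sym.
  + by apply: contra wB => /pB.
  move=> q z def_p; rewrite (last_arc up def_p) eq_sym setUC.
  by rewrite def_p last_rcons in col.
by rewrite last_rcons.
Qed.

Lemma cross_linked B c F w u p w' :
    w \notin B -> w' \notin B -> w != w' -> u \in B -> adj w u ->
    path (arc_in B c F) u p -> uniq (u :: p) -> p != [::] ->
    c [set w; u] != F (head u p) ->
    adj w' (last u p) -> c [set w'; last u p] != F (last u p) ->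
  linked c B w w'.
Proof.
move=> wB w'B ww' uB wu up p_uniq p0 col wp col'.
have pB : {subset u :: p <= B}.
  by move=> z; rewrite in_cons => /predU1P[->|/(directed_sub up)].
exists (rcons (u :: p) w'); split; last 1 first.
- move=> z; rewrite in_cons mem_rcons in_cons => /or3P[/eqP->|/eqP->|/pB zB].
  + by rewrite !inE eqxx.
  + by rewrite !inE eqxx orbT.
  + by rewrite inE zB orbT.
- apply: cpath_rcons.
  + exact: enter_cpath up p_uniq col.
  + by rewrite adj_sym.
  + by rewrite in_cons negb_or eq_sym ww'; apply: contra w'B => /pB.
  clear p_uniq col wp pB; case/lastP: p p0 up col' => [//|p z] _ up col' q z'.
  move=> /(@rcons_inj _ (u :: p))[<- <-] /=.
  rewrite (last_arc up erefl) eq_sym setUC.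
  by rewrite last_rcons in col'.
by rewrite last_rcons.
Qed.

End ColoredPaths.

(** * Renaming colors, and coloring the bridges that leave a block *)

Lemma linked_inj (G : sgraph) (C C' : eqType) (h : C -> C') (c : {set G} -> C) S x y :
  injective h -> linked c S x y -> linked (h \o c) S x y.
Proof.
move=> h_inj [p [/and3P[xp p_uniq colp] def_y pS]]; exists p; split=> //.
apply/and3P; split=> //.
have -> : pairmap (fun u v => (h \o c) [set u; v]) x p
        = map h (pairmap (fun u v => c [set u; v]) x p).
  by elim: (p) (x) => //= z q IHq a; rewrite IHq.
by rewrite sorted_map; apply: sub_sorted colp => a b /=; rewrite (inj_eq h_inj).
Qed.

(** For a bridge colored [a] at [u] and one colored [b] at [v]. Here [f] gives the labels and
    [s x y] the color of the first arc on the chosen path from [x] to [y]; the two cases use the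
    path from [u] to [v] and the one from [v] to [u]. *)
Definition compatible (V C : eqType) (f : V -> C) (s : V -> V -> C) u v (a b : C) :=
  ((a != s u v) && (b != f v)) || ((a != f u) && (b != s v u)).

Lemma compatibleC (V C : eqType) (f : V -> C) s u v a b :
  compatible f s u v a b = compatible f s v u b a.
Proof. by rewrite /compatible orbC andbC; congr (_ || _); rewrite andbC. Qed.

(** Such an [a] suits every [b]: if [b != f v], the path from [u] to [v] serves; otherwise [b]
    differs from [s v u], and the path from [v] to [u] does. *)
Lemma compatible_super (V C : eqType) (f : V -> C) s u v a b :
  s v u != f v -> a != f u -> a != s u v -> compatible f s u v a b.
Proof.
move=> sv au asu; rewrite /compatible au asu /=.
by have [->|] := eqVneq b (f v); rewrite ?orbT // eq_sym sv.
Qed.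

(* At most three bridges need a color among those of the block. If they leave
   the block from three vertices, the first one takes the label of its vertex,
   the others avoid theirs, and the second one also avoids the first color of
   the chosen path towards the third. *)
Lemma three_ports (V : eqType) (f : V -> 'I_3) (s : V -> V -> 'I_3) (a : 'I_3 -> V) :
    (forall i j, a i != a j -> s (a i) (a j) != f (a i)) ->
  exists g : 'I_3 -> 'I_3, forall i j, i != j ->
    if a i == a j then g i != g j else compatible f s (a i) (a j) (g i) (g j).
Proof.
pose o0 : 'I_3 := inord 0; pose o1 : 'I_3 := inord 1; pose o2 : 'I_3 := inord 2.
have o012 (i : 'I_3) : [|| i == o0, i == o1 | i == o2].
  by rewrite -!val_eqE /= !inordK //; case: i => -[|[|[|]]].
have o_neq : [/\ o0 != o1, o0 != o2 & o1 != o2] by rewrite -!val_eqE /= !inordK.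
pose R i j (x y : 'I_3) := if a i == a j then x != y else compatible f s (a i) (a j) x y.
have RC i j x y : R i j x y = R j i y x.
  by rewrite /R eq_sym compatibleC (eq_sym x).
move=> sP.
suff: exists x y z, [/\ R o0 o1 x y, R o0 o2 x z & R o1 o2 y z].
  case: o_neq => n01 n02 n12 [x [y [z [xy xz yz]]]].
  exists (fun i => if i == o0 then x else if i == o1 then y else z) => i j.
  rewrite -/(R i j _ _).
  case/or3P: (o012 i) => /eqP->; case/or3P: (o012 j) => /eqP->;
    rewrite ?eqxx // ?[o1 == o0]eq_sym ?[o2 == o0]eq_sym ?[o2 == o1]eq_sym
            ?(negPf n01) ?(negPf n02) ?(negPf n12) ?eqxx // => _;
    by rewrite RC.
have super i j : a i != a j ->
    exists x, forall y, compatible f s (a i) (a j) x y.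
  move=> aij; have [x /andP[xf xs]] := third_color (f (a i)) (s (a i) (a j)).
  by exists x => y; apply: compatible_super => //; apply: sP; rewrite eq_sym.
case: o_neq => n01 n02 n12.
have [a01|a01] := eqVneq (a o0) (a o1).
  have [a02|a02] := eqVneq (a o0) (a o2).
    by exists o0, o1, o2; rewrite /R -a01 -a02 eqxx.
  (* Two bridges share a vertex and the third leaves from another: the third takes a color that
     suits any other, and the first two only have to differ. *)
  have [|z zP] := super o2 o0; first by rewrite eq_sym.
  exists o0, o1, z; rewrite /R -a01 eqxx (negPf a02); split=> //;
    by rewrite compatibleC.
have [a02|a02] := eqVneq (a o0) (a o2).
  have [|y yP] := super o1 o0; first by rewrite eq_sym.
  exists o0, y, o2; rewrite /R -a02 eqxx (eq_sym (a o1)) (negPf a01); split=> //.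
  by rewrite compatibleC.
have [a12|a12] := eqVneq (a o1) (a o2).
  have [x xP] := super o0 o1 a01.
  by exists x, o1, o2; rewrite /R -a12 eqxx (negPf a01).
have [y /andP[yf ys]] := third_color (f (a o1)) (s (a o1) (a o2)).
have [z /andP[zf _]] := third_color (f (a o2)) (f (a o2)).
exists (f (a o0)), y, z; rewrite /R (negPf a01) (negPf a02) (negPf a12).
rewrite /compatible yf ys zf !(eq_sym (f (a o0))) !sP //.
Qed.

Lemma block_good (G : sgraph) (B : {set G}) (v : G) (k : nat) :
    v \in B -> orientable B -> bridged B -> #|outer B| <= k.+3 ->
  exists c : {set G} -> 'I_k.+3, good c B.
Proof.
move=> vB [c0 [f0 cfP]] brB leBk.
pose emb : 'I_3 -> 'I_k.+3 := widen_ord (isT : 3 <= k.+3).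
have emb_inj : injective emb by move=> x y /eqP; rewrite -val_eqE => /= /eqP/ord_inj.
have /fin_all_exists[P PP] : forall q : G * G, exists p : seq G,
    q.1 \in B -> q.2 \in B ->
    [/\ path (arc_in B c0 f0) q.1 p, uniq (q.1 :: p) & last q.1 p = q.2].
  case=> x y /=.
  have [xB|_] := boolP (x \in B); last by exists [::].
  have [yB|_] := boolP (y \in B); last by exists [::].
  have /connectP[p0 p0P ->] := cfP x y xB yB.
  by case/shortenP: p0P => p pP p_uniq _; exists p.
have P0 x y : x \in B -> y \in B -> x != y -> P (x, y) != [::].
  move=> xB yB; apply: contraNneq => Pxy.
  by have [_ _ /= <-] := PP (x, y) xB yB; rewrite Pxy.
have /fin_all_exists[att attP] : forall w : G, exists u : G,
    w \in outer B -> u \in B /\ adj w u.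
  move=> w.
  by case: (outerP B w) => [[_ [u uB wu]]|_]; [exists u | exists w].
have outerN w : w \in outer B -> w \notin B by case/outerP.
pose ws := enum (outer B); pose idx w := index w ws.
have wsP w : (w \in ws) = (w \in outer B) by rewrite mem_enum.
have idx_lt w : w \in outer B -> idx w < k.+3.
  by rewrite -wsP -index_mem => /leq_trans; apply; rewrite -cardE.
(* When fewer than three bridges leave [B], the missing ports default to [v], which lies in [B]. *)
pose a (j : 'I_3) := nth v (map att ws) j.
have aB j : a j \in B.
  rewrite /a; have [lt_j|ge_j] := ltnP j (size ws).
    by rewrite (nth_map v) //; have /attP[] : nth v ws j \in outer B by rewrite -wsP mem_nth.
  by rewrite nth_default // size_map.
have a_idx w (lt_w : idx w < 3) : w \in outer B -> a (inord (idx w)) = att w.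
  by rewrite -wsP => w_ws; rewrite /a inordK // (nth_map v) ?index_mem // nth_index.
pose s x y := f0 (head x (P (x, y))).
have s_neq x y : x \in B -> y \in B -> x != y -> s x y != f0 x.
  move=> xB yB xy; have [] := PP (x, y) xB yB.
  have := P0 x y xB yB xy; rewrite /s /=; case: (P _) => //= z p _.
  by case/andP => /and3P[/and3P[_ _]]; rewrite eq_sym.
have [gam gamP] := three_ports (fun i j => s_neq _ _ (aB i) (aB j)).
(* The first three bridges get the colors from [three_ports]; each later one has its own index, at
   least 3, as a private color. *)
pose g w : 'I_k.+3 := if idx w < 3 then emb (gam (inord (idx w))) else inord (idx w).
have g_free w t : w \in outer B -> 3 <= idx w -> g w != emb t.
  move=> wB le3; rewrite /g ltnNge le3 /= -val_eqE /= inordK ?idx_lt //.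
  by apply: contraTneq le3 => ->; rewrite -ltnNge.
pose F := emb \o f0; pose sF x y := emb (s x y).
have gP w w' : w \in outer B -> w' \in outer B -> w != w' ->
    if att w == att w' then g w != g w'
    else compatible F sF (att w) (att w') (g w) (g w').
  move=> wB w'B ww'.
  have idx_neq : idx w != idx w'.
    by apply: contraNneq ww' => /index_inj->; rewrite ?wsP.
  have [attww'|attww'] := eqVneq (att w) (att w').
    have [lt_w|ge_w] := ltnP (idx w) 3; last first.
      have [lt_w'|ge_w'] := ltnP (idx w') 3.
        by rewrite [g w']/g lt_w' g_free.
      rewrite /g (ltnNge (idx w)) (ltnNge (idx w')) ge_w ge_w' /=; apply: contra idx_neq => /eqP/(congr1 val).
      by rewrite /= !inordK ?idx_lt // => ->.
    have [lt_w'|ge_w'] := ltnP (idx w') 3; last first.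
      by rewrite eq_sym [g w]/g lt_w g_free.
    have idx_neq' : inord (idx w) != inord (idx w') :> 'I_3.
      by apply: contra idx_neq => /eqP/(congr1 val); rewrite /= !inordK // => ->.
    have := gamP _ _ idx_neq'; rewrite !a_idx // attww' eqxx.
    by rewrite /g lt_w lt_w' (inj_eq emb_inj).
  have [awB _] := attP w wB; have [aw'B _] := attP w' w'B.
  have [lt_w|ge_w] := ltnP (idx w) 3; last first.
    apply: compatible_super; rewrite ?g_free //.
    by rewrite (inj_eq emb_inj) s_neq // eq_sym.
  have [lt_w'|ge_w'] := ltnP (idx w') 3; last first.
    rewrite compatibleC; apply: compatible_super; rewrite ?g_free //.
    by rewrite (inj_eq emb_inj) s_neq.
  have idx_neq' : inord (idx w) != inord (idx w') :> 'I_3.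
    by apply: contra idx_neq => /eqP/(congr1 val); rewrite /= !inordK // => ->.
  have := gamP _ _ idx_neq'; rewrite !a_idx // (negPf attww').
  by rewrite /compatible /g lt_w lt_w' !(inj_eq emb_inj).
(* A vertex of [outer B] identifies a bridge among the edges meeting [B], since edges inside [B]
   contain none. *)
pose cB (A : {set G}) :=
  if [pick w in outer B | w \in A] is Some w then g w else emb (c0 A).
have cB_out w u : w \in outer B -> u \in B -> cB [set w; u] = g w.
  move=> wB uB; rewrite /cB; case: pickP => [w' /andP[w'B]|/(_ w)].
    rewrite !inE => /orP[/eqP-> // | /eqP def_u].
    by move: (outerN _ w'B); rewrite def_u uB.
  by rewrite /= wB !inE eqxx.
have cB_in x y : x \in B -> y \in B -> cB [set x; y] = emb (c0 [set x; y]).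
  move=> xB yB; rewrite /cB; case: pickP => // w /andP[/outerN wB].
  by rewrite !inE => /orP[] /eqP def_w; rewrite def_w ?xB ?yB in wB.
have {}PP x y : x \in B -> y \in B ->
    [/\ path (arc_in B cB F) x (P (x, y)), uniq (x :: P (x, y)) & last x (P (x, y)) = y].
  move=> xB yB; have [/= xy xy_uniq lastxy] := PP (x, y) xB yB; split=> //.
  apply: sub_path xy => b d /and3P[/and3P[bd /eqP cbd fbd] bB dB].
  apply/and3P; split=> //; apply/and3P; split=> //.
    by rewrite cB_in // cbd.
have outer_in w y : w \in outer B -> y \in B -> linked cB B w y.
  move=> wB yB; have [uB wu] := attP w wB; have wNB := outerN w wB.
  have [uy|uy] := eqVneq (att w) y.
    by apply: linked_edge; rewrite -uy.
  (* If the bridge clashes with the first arc towards [y], the path from [y] is used instead: it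
     ends with the label of [att w], which differs from the color of that first arc. *)
  have [col|col] := eqVneq (g w) (sF (att w) y); last first.
    have [up up_uniq <-] := PP (att w) y uB yB.
    by apply: (enter_linked _ _ _ up) => //; rewrite cB_out.
  apply: linked_sym; have [yp yp_uniq lastyp] := PP y (att w) yB uB.
  apply: (exit_linked _ _ yp); rewrite ?lastyp //.
  by rewrite cB_out // col (inj_eq emb_inj) s_neq.
have cross w w' : w \in outer B -> w' \in outer B -> w != w' -> att w != att w' ->
    g w != sF (att w) (att w') -> g w' != F (att w') -> linked cB B w w'.
  move=> wB w'B ww' aww' col col'.
  have [uB wu] := attP w wB; have [u'B w'u'] := attP w' w'B.
  have [up up_uniq lastp] := PP (att w) (att w') uB u'B.
  apply: (cross_linked _ _ _ _ _ up); rewrite ?lastp ?cB_out ?outerN ?P0 //.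
exists cB => x y; rewrite !nbhdE => /orP[xB|xB] /orP[yB|yB].
- have [xy xy_uniq <-] := PP x y xB yB.
  exact: directed_linked xy xy_uniq.
- exact/linked_sym/outer_in.
- exact: outer_in.
have [<-|xy] := eqVneq x y; first exact: linked_refl.
have [uB xu] := attP x xB; have [u'B yu'] := attP y yB.
have := gP x y xB yB xy; case: ifPn => [/eqP u_eq col|u_neq].
  exists [:: att x; y]; split=> // [|z]; last first.
    by rewrite !inE => /or3P[]/eqP->; rewrite ?eqxx ?uB ?orbT.
  apply: cpath_cons => //.
  - rewrite !inE negb_or xy andbT.
    by apply: contraTneq xu => <-; rewrite adj_irr.
  - apply: cpath_cons => //; first by rewrite u_eq adj_sym.
    by rewrite inE u_eq; apply: contraTneq yu' => ->; rewrite adj_irr.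
  by move=> z q [<- _]; rewrite (setUC [set att x]) !cB_out.
case/orP=> /andP[col col']; first exact: cross.
by apply/linked_sym/cross; rewrite // eq_sym.
Qed.

(** * Gluing along a bridge *)

Section Glue.

Variables (G : sgraph) (C : eqType).
Implicit Types (c : {set G} -> C) (S B D : {set G}) (x y z u w : G).

Lemma cpath_eq c c' D x p :
    {in D &, forall a b, adj a b -> c [set a; b] = c' [set a; b]} ->
    {subset x :: p <= D} -> cpath c x p -> cpath c' x p.
Proof.
move=> cc' pD /and3P[xp p_uniq colp]; apply/and3P; split=> //.
suff <- : pairmap (fun u v => c [set u; v]) x p
        = pairmap (fun u v => c' [set u; v]) x p by [].
elim: p x xp pD {p_uniq colp} => //= y p IHp x /andP[xy yp] pD.
rewrite cc' ?IHp // ?pD ?inE ?eqxx ?orbT // => z zp.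
by apply: pD; rewrite inE zp orbT.
Qed.

(** Two such adjacent vertices would give their component a second edge into [S]. *)
Lemma bridged_nbhd_nonadj S x y :
    bridged S -> x \in nbhd S -> y \in nbhd S -> x \notin S -> y \notin S ->
  ~~ adj x y.
Proof.
move=> brS xN yN xS yS; apply/negP => xy.
move: xN yN; rewrite !nbhdE (negPf xS) (negPf yS) /=.
case/outerP=> _ [s sS xs] /outerP[_ [t tS yt]].
have [|||_ eq_xy] := brS s t x y sS tS xS yS; try by rewrite adj_sym.
  by apply: connect1; apply/and3P.
by rewrite eq_xy adj_irr in xy.
Qed.

(** Along a path witnessing [linked], only colors of edges meeting [S] matter, so all other edges
    can be recolored. *)
Lemma linked_edge_touch S x y D a b :
    bridged S -> x \in nbhd S -> y \in nbhd S -> D \subset [set x; y] :|: S ->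
    a \in D -> b \in D -> adj a b ->
  (a \in S) || (b \in S).
Proof.
move=> brS xN yN /subsetP DS /DS aD /DS bD ab; case: (boolP (a \in S)) => //= aS.
have DN z : z \in [set x; y] :|: S -> z \in nbhd S.
  rewrite in_setU in_set2 -orbA => /or3P[/eqP->|/eqP->|zS] //.
  exact: (subsetP (subset_nbhd S)).
apply: contraTT ab => bS; apply: (bridged_nbhd_nonadj brS) => //; exact: DN.
Qed.

Variables (S B : {set G}) (u w : G) (c1 c2 : {set G} -> C).
Hypotheses (brS : bridged S) (brB : bridged B) (SB : [disjoint S & B]).
Hypotheses (uS : u \in S) (wB : w \in B) (uw : adj u w).
Hypothesis conB : {in B &, forall x y, connect (outside S) x y}.
Hypotheses (c1P : good c1 S) (c2P : good c2 B).
Hypothesis c12 : c1 [set u; w] = c2 [set u; w].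

Let notS x : x \in B -> x \notin S.
Proof. by move=> xB; apply: contraL xB => /(disjointFr SB)->. Qed.

Let notB x : x \in S -> x \notin B.
Proof. by move=> /(disjointFr SB)->. Qed.

(** By [conB], [B] lies in one component outside [S], whose only edge into [S] is [uw]. *)
Let crossing s b : s \in S -> b \in B -> adj s b -> s = u /\ b = w.
Proof. by move=> sS bB sb; apply: brS; rewrite ?notS ?conB. Qed.

(** Only the bridge [uw] meets both [S] and [B], and [c12] holds there; giving priority to [S] thus
    leaves every edge that meets [B] its color under [c2]. *)
Let glue (A : {set G}) := if [disjoint A & S] then c2 A else c1 A.

Let glueS a b : (a \in S) || (b \in S) -> glue [set a; b] = c1 [set a; b].
Proof.
rewrite /glue => abS; case: ifP => // /pred0P dis.
by case/orP: abS => [aS|bS]; [have := dis a | have := dis b];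
  rewrite /= !inE eqxx ?orbT ?aS ?bS.
Qed.

Let glueB a b : (a \in B) || (b \in B) -> adj a b -> glue [set a; b] = c2 [set a; b].
Proof.
move=> abB ab; case: (boolP ((a \in S) || (b \in S))) => abS.
  rewrite glueS //; case/orP: abB => [aB|bB].
    rewrite (negPf (notS aB)) /= in abS.
    by have [|-> ->] := crossing abS aB; [rewrite adj_sym | rewrite setUC].
  rewrite (negPf (notS bB)) orbF in abS.
  by have [-> ->] := crossing abS bB ab.
rewrite /glue; case: ifPn => // /pred0Pn[z /andP[]].
by rewrite !inE => /orP[] /eqP-> zS; rewrite zS ?orbT in abS.
Qed.

Let linkS x y : x \in nbhd S -> y \in nbhd S -> exists p,
  [/\ cpath glue x p, last x p = y & {subset x :: p <= [set x; y] :|: S}].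
Proof.
move=> xN yN; have [p [xp lastp pS]] := c1P xN yN; exists p; split=> //.
apply: cpath_eq pS xp => a b aD bD ab.
by rewrite glueS // (linked_edge_touch brS xN yN (subxx _) aD bD ab).
Qed.

Let linkB x y : x \in nbhd B -> y \in nbhd B -> exists p,
  [/\ cpath glue x p, last x p = y & {subset x :: p <= [set x; y] :|: B}].
Proof.
move=> xN yN; have [p [xp lastp pB]] := c2P xN yN; exists p; split=> //.
apply: cpath_eq pB xp => a b aD bD ab.
by rewrite glueB // (linked_edge_touch brB xN yN (subxx _) aD bD ab).
Qed.

(** A path from [x] to [w] through [S] ends with the bridge [uw], and a path from [u] to [y] through
    [B] begins with it; [cpath_cat] merges them along this edge. *)
Let linkSB x y : x \in nbhd S -> x \notin nbhd B -> y \in nbhd B -> y \notin nbhd S ->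
  linked glue (S :|: B) x y.
Proof.
move=> xS xB yB yS.
have wN : w \in nbhd S by apply/nbhdP; right; exists u; rewrite // adj_sym.
have uN : u \in nbhd B by apply/nbhdP; right; exists w.
have [p [xp lastp pS]] := linkS xS wN.
have [q [uq lastq qB]] := linkB uN yB.
have wNS := notS wB; have uNB := notB uS.
case/lastP: p => [|p w'] in xp lastp pS.
  by rewrite /= in lastp; rewrite lastp (subsetP (subset_nbhd B)) in xB.
rewrite last_rcons in lastp; rewrite {w'}lastp in xp pS.
have pw : adj (last x p) w by case/and3P: (xp); rewrite rcons_path => /andP[].
have [wp wx] : w \notin p /\ x != w.
  case/and3P: (xp) => _; rewrite cons_uniq rcons_uniq mem_rcons in_cons negb_or.
  by case/andP => /andP[-> _] /andP[].
have pS' z : z \in x :: p -> (z == x) || (z \in S).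
  move=> zp; have zw : z != w.
    by apply: contraTneq zp => ->; rewrite in_cons negb_or eq_sym wx.
  have: z \in x :: rcons p w by rewrite -rcons_cons mem_rcons in_cons zp orbT.
  by move/pS; rewrite !inE (negPf zw) orbF.
have last_p : last x p = u.
  have lastS : last x p \in S.
    have := linked_edge_touch brS xS wN (subxx _) _ _ pw.
    rewrite (negPf wNS) orbF; apply; last by rewrite !inE eqxx ?orbT.
    by apply: pS; rewrite -rcons_cons mem_rcons in_cons mem_last orbT.
  by have [] := crossing lastS wB pw.
case: q => [|w' q] in uq lastq qB.
  by rewrite /= in lastq; rewrite -lastq (subsetP (subset_nbhd S)) in yS.
have uw' : adj u w' by case/and3P: (uq) => /andP[].
have w'B : w' \in B.
  have := linked_edge_touch brB uN yB (subxx _) _ _ uw'.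
  by rewrite (negPf uNB); apply; apply: qB; rewrite !inE eqxx ?orbT.
have [_ def_w'] := crossing uS w'B uw'; rewrite {w' uw' w'B}def_w' in uq lastq qB.
have uwq : u \notin w :: q by case/and3P: uq => _; rewrite cons_uniq => /andP[].
have qB' z : z \in w :: q -> (z == y) || (z \in B).
  move=> zq; have zu : z != u by apply: contraTneq zq => ->.
  have /qB : z \in [:: u, w & q] by rewrite in_cons zq orbT.
  by rewrite !inE (negPf zu).
exists (p ++ w :: q); split; last 1 first.
- move=> z; rewrite -cat_cons mem_cat => /orP[/pS'|/qB']; rewrite !inE.
    by case/orP=> ->; rewrite ?orbT.
  by case/orP=> ->; rewrite ?orbT.
- apply: cpath_cat => //; first by rewrite last_p.
  move=> z /pS' zS; apply/negP => /qB' zB.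
  case/orP: zS => [/eqP def_z|zS].
    rewrite {z}def_z in zB; case/orP: zB => [/eqP def_x|zB].
      by rewrite def_x yB in xB.
    by rewrite (subsetP (subset_nbhd B)) in xB.
  case/orP: zB => [/eqP def_z|zB]; last by rewrite (disjointFr SB zS) in zB.
  by rewrite -def_z (subsetP (subset_nbhd S)) in yS.
by rewrite last_cat /= -lastq.
Qed.

Lemma glue_good : exists c, good c (S :|: B).
Proof.
exists glue => x y.
have nbhdU z : z \in nbhd (S :|: B) -> (z \in nbhd S) || (z \in nbhd B).
  case/nbhdP=> [|[t]]; rewrite inE => /orP[tS|tS].
  - by rewrite (subsetP (subset_nbhd S)).
  - by rewrite (subsetP (subset_nbhd B)) ?orbT.
  - by move=> zt; apply/orP; left; apply/nbhdP; right; exists t.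
  - by move=> zt; apply/orP; right; apply/nbhdP; right; exists t.
have inS a b : a \in nbhd S -> b \in nbhd S -> linked glue (S :|: B) a b.
  move=> aS bS; have [p [ap lastp pS]] := linkS aS bS; exists p; split=> // z /pS.
  by rewrite !inE => /orP[] ->; rewrite ?orbT.
have inB a b : a \in nbhd B -> b \in nbhd B -> linked glue (S :|: B) a b.
  move=> aS bS; have [p [ap lastp pS]] := linkB aS bS; exists p; split=> // z /pS.
  by rewrite !inE => /orP[] ->; rewrite ?orbT.
move=> /nbhdU xSB /nbhdU ySB.
have [xS|xS] := boolP (x \in nbhd S); have [yS|yS] := boolP (y \in nbhd S).
- exact: inS.
- rewrite (negPf yS) in ySB; have [xB|xB] := boolP (x \in nbhd B); first exact: inB.
  exact: linkSB.
- rewrite (negPf xS) in xSB; have [yB|yB] := boolP (y \in nbhd B); first exact: inB.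
  exact/linked_sym/linkSB.
by rewrite (negPf xS) in xSB; rewrite (negPf yS) in ySB; apply: inB.
Qed.

(** A component with edges into both [S] and [B] would offer a second way from [S] to [B] besides
    [uw]; if both edges go to the same set, that set is bridged. *)
Lemma bridgedU : bridged (S :|: B).
Proof.
have wsub x y : connect (outside (S :|: B)) x y -> connect (outside S) x y.
  exact/outside_sub/subsetUl.
have only_w s b x y : s \in S -> b \in B -> x \notin S -> y \notin S -> adj s x ->
    adj b y -> connect (outside S) x y -> x \in B.
  move=> sS bB xS yS sx by_ xy; have bS := notS bB.
  have wx : connect (outside S) w x.
    apply: connect_trans (conB wB bB) _; rewrite outside_connect_sym.
    apply: connect_trans xy _; rewrite outside_connect_sym.
    by apply: connect1; apply/and3P.
  by have [_ <-] := brS uS sS (notS wB) xS uw sx wx.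
move=> a b x y aSB bSB; rewrite !in_setU !negb_or => /andP[xS xB] /andP[yS yB] ax by_ xy.
move: aSB bSB; rewrite !in_setU => /orP[aS|aB] /orP[bS|bB].
- exact: brS (wsub _ _ xy).
- by rewrite (only_w a b x y) // in xB; apply: wsub.
- rewrite (only_w b a y x) // in yB; apply: wsub.
  by rewrite outside_connect_sym.
by apply: brB => //; apply: outside_sub xy; apply: subsetUr.
Qed.

End Glue.

(** * From blocks to the whole graph *)

Lemma good_of_blocks (G : sgraph) (k : nat) (v0 : G) :
    connected G ->
    (forall (B : {set G}) v, v \in B -> bridged B -> #|outer B| <= k.+3) ->
  exists c : {set G} -> 'I_k.+3, good c setT.
Proof.
move=> Gconn blocks.
(* [S] is the union of the blocks treated so far; the induction is on the size of its complement. *)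
suff grow m (S : {set G}) (c : {set G} -> 'I_k.+3) : #|~: S| <= m -> v0 \in S ->
    bridged S -> good c S -> exists c : {set G} -> 'I_k.+3, good c setT.
  have [B [v0B orB brB]] := block_exists v0.
  have [c cP] := block_good v0B orB brB (blocks B v0 v0B brB).
  exact: grow (leqnn _) v0B brB cP.
elim: m S c => [|m IHm] S c leSm v0S brS cP.
  exists c; suff -> : [set: G] = S by [].
  by move: leSm; rewrite leqn0 => /eqP/cards0_eq/(congr1 (@setC _)); rewrite setCK setC0.
have [z zS|allS] := pickP [pred z | z \notin S]; last first.
  exists c; suff -> : [set: G] = S by [].
  by apply/setP => z; rewrite inE; have /= /negbFE-> := allS z.
have [u [w [uS wS uw _]]] := connect_exit (Gconn v0 z) v0S zS.
have [B [wB orB brB]] := block_exists w.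
have SB := bridged_orientable_disjoint brS orB wB wS uS uw.
have [c2 c2P] := block_good wB orB brB (blocks B w wB brB).
(* This transposition gives the bridge [uw] the color it already has on the side of [S]. *)
pose h := tperm (c2 [set u; w]) (c [set u; w]).
have hP : good (h \o c2) B.
  by move=> x y xN yN; apply: linked_inj (c2P x y xN yN); apply: perm_inj.
have ch : c [set u; w] = (h \o c2) [set u; w] by rewrite /= tpermL.
have conB : {in B &, forall x y, connect (outside S) x y}.
  case: orB => [d [f dfP]] x y xB yB; apply: connect_sub (dfP x y xB yB) => a b.
  case/and3P=> /and3P[ab _ _] aB bB; apply: connect1; apply/and3P; split=> //.
    by rewrite (disjointFl SB aB).
  by rewrite (disjointFl SB bB).
have [c' c'P] := glue_good brS brB SB uS wB uw conB cP hP ch.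
apply: (IHm (S :|: B) c') => //.
- rewrite -ltnS; apply: leq_trans leSm; apply: proper_card.
  rewrite properEneq setCS subsetUl andbT; apply/eqP => /setP/(_ w).
  by rewrite !inE wB wS orbT.
- by rewrite inE v0S.
exact: bridgedU brS brB SB uS wB uw conB.
Qed.

Lemma colorable_of_blocks (G : sgraph) (k : nat) :
    connected G ->
    (forall (B : {set G}) v, v \in B -> bridged B -> #|outer B| <= k.+3) ->
  proper_path_colorable G k.+3.
Proof.
move=> Gconn blocks; have [v0 _|G0] := pickP (@predT G); last first.
  by apply/existsP; exists [ffun=> ord0]; apply/forallP => x; have := G0 x.
have [c cP] := good_of_blocks v0 Gconn blocks.
apply/existsP; exists (finfun c); apply/forallP => x; apply/forallP => y.
have inN z : z \in nbhd [set: G] by apply/nbhdP; left; rewrite inE.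
apply/implyP => _; apply/proper_connectedP.
have [p [xp lastp _]] := cP x y (inN x) (inN y); exists p => //.
apply: (@cpath_eq _ _ c (finfun c : edge_coloring G k.+3) setT) => //.
  by move=> a b _ _ _; rewrite ffunE.
by move=> z _; rewrite in_setT.
Qed.

(** * Counting beyond the bridges; spiders *)

Lemma min_degree_le (G : sgraph) (x : G) : min_degree G <= degree x.
Proof.
rewrite /min_degree; have := mem_index_enum x; elim: (index_enum G) => // y s IHs.
rewrite inE big_cons => /predU1P[<-|/IHs]; first exact: geq_minl.
exact: leq_trans (geq_minr _ _).
Qed.

Section Branches.

Variables (G : sgraph) (B : {set G}) (d : nat).
Hypotheses (Gconn : connected G) (brB : bridged B).
Hypotheses (d_ge2 : 2 <= d) (degG : forall x : G, d <= degree x).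
Implicit Types (u w z t : G).

Definition branch w := [set z | connect (outside B) w z].

Lemma branch_refl w : w \in branch w.
Proof. by rewrite inE connect0. Qed.

Lemma branch_outside w z : w \in outer B -> z \in branch w -> z \notin B.
Proof.
case/outerP => wB _; rewrite inE => /connectP[p wp ->].
case/lastP: p wp => //= p t; rewrite rcons_path last_rcons => /andP[_].
by case/and3P.
Qed.

Lemma branch_inj w w' z :
  w \in outer B -> w' \in outer B -> z \in branch w -> z \in branch w' -> w = w'.
Proof.
case/outerP=> wB [u uB wu] /outerP[w'B [u' u'B w'u']]; rewrite !inE => wz w'z.
suff [] : u = u' /\ w = w' by [].
apply: (@brB u u' w w') => //; try by rewrite adj_sym.
by apply: connect_trans wz _; rewrite outside_connect_sym.
Qed.

Lemma branch_cover z : B != set0 -> z \notin B -> exists2 w, w \in outer B & z \in branch w.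
Proof.
case/set0Pn=> v vB zB; have zNB : z \in [predC B] by rewrite inE.
have vNB : v \notin [predC B] by rewrite inE negbK.
have [a [b [aB bB ab za]]] := connect_exit (Gconn z v) zNB vNB.
rewrite !inE ?negbK in aB bB.
exists a; first by apply/outerP; split=> //; exists b.
rewrite inE outside_connect_sym; apply: connect_sub za => x y /and3P[xy xB yB].
by apply: connect1; apply/and3P.
Qed.

(** A neighbor of [z] in [B] would make [z] the end of the bridge, which is [w]. *)
Lemma branch_closed w z t :
  w \in outer B -> z \in branch w -> z != w -> adj z t -> t \in branch w.
Proof.
move=> wB zw zNw zt; have zB := branch_outside wB zw; rewrite inE in zw.
have [tB|tB] := boolP (t \in B).
  case/outerP: wB => wB [u uB wu]; case/eqP: zNw.
  suff [] : u = t /\ w = z by [].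
  by apply: (@brB u t w z); rewrite // adj_sym.
rewrite inE; apply: connect_trans zw _; apply: connect1; exact/and3P.
Qed.

Lemma card_closed_nbhd z : d < #|z |: [set t | adj z t]|.
Proof. by rewrite cardsU1 inE adj_irr; apply: degG. Qed.

Lemma closed_nbhd_branch w z : w \in outer B -> z \in branch w -> z != w ->
  z |: [set t | adj z t] \subset branch w.
Proof.
move=> wB zw zNw; apply/subsetP => t; rewrite in_setU1 inE => /predU1P[-> //|].
exact: branch_closed.
Qed.

(** As [w] has degree at least 2, it has a neighbor [z] besides the end of its bridge in [B]; the
    closed neighborhood of [z] lies in the branch. *)
Lemma card_branch w : w \in outer B -> d < #|branch w|.
Proof.
move=> wB; have /outerP[wNB [u uB wu]] := wB.
have [z /andP[wz zu]] : exists z, adj w z && (z != u).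
  apply/existsP; rewrite -[[exists _, _]]negbK negb_exists; apply/negP => /forallP noz.
  have : degree w <= #|[set u]|.
    apply/subset_leq_card/subsetP => z; rewrite !inE => wz.
    by have := noz z; rewrite wz /= negbK.
  by rewrite cards1 leqNgt (leq_trans d_ge2).
have zNB : z \notin B.
  apply: contra zu => zB; apply/eqP.
  suff [] : z = u /\ w = w by [].
  by apply: (@brB z u w w); rewrite ?connect0 // adj_sym.
have zw : z \in branch w by rewrite inE; apply: connect1; apply/and3P.
have zNw : z != w by apply: contraTneq wz => ->; rewrite adj_irr.
exact: leq_trans (card_closed_nbhd z) (subset_leq_card (closed_nbhd_branch wB zw zNw)).
Qed.

(** A branch of this size is the closed neighborhood of each of its vertices other than [w];
    symmetry settles [w]. *)
Lemma branch_clique w : w \in outer B -> #|branch w| = d.+1 ->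
  {in branch w &, forall z t, z != t -> adj z t}.
Proof.
move=> wB dw; suff half z t : z \in branch w -> t \in branch w -> z != t -> z != w -> adj z t.
  move=> z t zw tw zt; have [z_eq|] := eqVneq z w; last exact: half.
  by rewrite adj_sym; apply: half; rewrite // -?z_eq eq_sym.
move=> zw tw zt zNw.
have := closed_nbhd_branch wB zw zNw; rewrite subEproper => /orP[/eqP def_w|].
  by move: tw; rewrite -def_w in_setU1 eq_sym (negPf zt) inE.
by move/proper_card; rewrite dw ltnS leqNgt card_closed_nbhd.
Qed.

(** Double counting: each vertex outside [B] lies in at most one branch, and vertices of [B] in
    none. *)
Lemma sum_branches : \sum_(w in outer B) #|branch w| + #|B| <= #|G|.
Proof.
rewrite -(cardC (mem B)) addnC leq_add2l.
under eq_bigr => w _ do rewrite -sum1_card big_mkcond /=.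
rewrite exchange_big /= -sum1_card [leqRHS]big_mkcond /=; apply: leq_sum => z _.
case: ifPn => [zB|]; last first.
  rewrite inE negbK => zB; rewrite big1 // => w wB; case: ifP => // zw.
  by rewrite (negPf (branch_outside wB zw)) in zB.
rewrite -big_mkcondr /=; have [w0 /andP[w0B zw0]|no_w] := pickP [pred w in outer B | z \in branch w].
  rewrite (bigD1 w0) ?w0B //= big1 ?addn0 // => w /andP[/andP[wB zw] /eqP[]].
  exact: branch_inj zw zw0.
by rewrite big1 // => w; have /= -> := no_w w.
Qed.

Lemma card_outer : #|outer B| * d.+1 + #|B| <= #|G|.
Proof.
apply: leq_trans sum_branches; rewrite leq_add2r -sum_nat_const.
exact/leq_sum/card_branch.
Qed.

(** [B] takes at least one vertex and each branch at least [d.+1], so the total leaves no branch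
    room for more. *)
Lemma card_branch_eq w :
    B != set0 -> #|outer B| * d.+1 + 1 = #|G| -> w \in outer B -> #|branch w| = d.+1.
Proof.
rewrite -card_gt0 => B0 eqG wB; apply/eqP; rewrite eqn_leq card_branch // andbT.
have := sum_branches; rewrite -eqG (bigD1 w) //=.
have : #|outer B|.-1 * d.+1 <= \sum_(i in outer B | i != w) #|branch i|.
  have -> : #|outer B|.-1 = #|outer B :\ w| by rewrite (cardsD1 w (outer B)) wB.
  rewrite -sum_nat_const [leqRHS](eq_bigl (mem (outer B :\ w))); last first.
    by move=> i; rewrite !inE andbC.
  by apply: leq_sum => i; rewrite in_setD1 => /andP[_ /card_branch].
have : 0 < #|outer B| by apply/card_gt0P; exists w.
case: #|outer B| => // r _ /=; rewrite mulSn; lia.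
Qed.

Lemma spider_of_branches v r :
    B = [set v] -> #|outer B| = r.+1 -> r.+1 * d.+1 + 1 = #|G| ->
  isomorphic G (S_graph r.+1 d.+1).
Proof.
move=> Bv outr eqG; have B0 : B != set0 by rewrite Bv; apply/set0Pn; exists v; apply: set11.
have dw w : w \in outer B -> #|branch w| = d.+1.
  by apply: card_branch_eq; rewrite ?outr.
have inB z : (z \in B) = (z == v) by rewrite Bv inE.
have /fin_all_exists[root rootP] : forall z : G, exists w : G,
    z != v -> w \in outer B /\ z \in branch w.
  move=> z; have [->|zv] := eqVneq z v; first by exists v.
  have [|w wB zw] := @branch_cover z B0; first by rewrite inB.
  by exists w.
have root_eq z w : z != v -> w \in outer B -> z \in branch w -> root z = w.
  by move=> /rootP[rB zr] wB zw; apply: branch_inj zr zw.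
(* Listing [w] first gives it index 0, the index joined to the center in [S_adj]. *)
pose bseq w := w :: enum (branch w :\ w).
have bseqP w z : w \in outer B -> (z \in bseq w) = (z \in branch w).
  move=> wB; rewrite in_cons mem_enum in_setD1.
  by case: eqVneq => //= ->; rewrite branch_refl.
have size_bseq w : w \in outer B -> size (bseq w) = d.+1.
  move=> wB; rewrite /= -cardE; congr _.+1; apply/eqP.
  by rewrite -eqSS -(dw w wB) (cardsD1 w (branch w)) branch_refl.
pose i z := index (root z) (enum (outer B)); pose j z := index z (bseq (root z)).
have lt_i z : z != v -> i z < r.+1.
  by move=> /rootP[rB _]; rewrite -outr cardE index_mem mem_enum.
have lt_j z : z != v -> j z < d.+1.
  by move=> /rootP[rB zr]; rewrite -(size_bseq _ rB) index_mem bseqP.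
have i_inj y z : y != v -> z != v -> i y = i z -> root y = root z.
  move=> /rootP[yB _] /rootP[zB _]; by apply: (index_inj v); rewrite mem_enum.
have j_inj y z : y != v -> z != v -> root y = root z -> j y = j z -> y = z.
  move=> yv zv yz; have [zB zr] := rootP z zv; have [_ yr] := rootP y yv.
  rewrite /j yz in yr *; by apply: (index_inj v); rewrite bseqP.
pose f z : S_graph r.+1 d.+1 :=
  if z == v then None else Some (inord (i z), inord (j z)).
have fS z : z != v -> f z = Some (inord (i z), inord (j z)) by rewrite /f => /negPf->.
have fv : f v = None by rewrite /f eqxx.
have inord_eq n a b : a < n.+1 -> b < n.+1 -> (inord a == inord b :> 'I_n.+1) = (a == b).
  by move=> lta ltb; rewrite -val_eqE /= !inordK.
have f_inj : injective f.
  move=> y z; have [->|yv] := eqVneq y v.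
    by have [->//|zv] := eqVneq z v; rewrite fv fS.
  have [->|zv] := eqVneq z v; first by rewrite fv fS.
  rewrite !fS // => -[/eqP + /eqP]; rewrite !inord_eq ?lt_i ?lt_j //.
  by move=> /eqP/(i_inj _ _ yv zv) yz /eqP/(j_inj _ _ yv zv yz).
exists f; first by apply: inj_card_bij f_inj _; rewrite card_option card_prod !card_ord -eqG addn1.
have adj_v z : z != v -> adj v z = (j z == 0).
  move=> zv; have [rB zr] := rootP z zv; apply/idP/idP => [vz|].
    have zB : z \in outer B.
      by apply/outerP; split; rewrite ?inB //; exists v; rewrite ?inB // adj_sym.
    by rewrite /j /= (root_eq z z) ?branch_refl //= eqxx.
  rewrite /j /=; case: ifP => // /eqP root_z _; case/outerP: rB => _ [u].
  by rewrite inB root_z adj_sym => /eqP->.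
move=> y z; have [->|yv] := eqVneq y v; have [->|zv] := eqVneq z v.
- by rewrite !fv !adj_irr.
- by rewrite fv fS // adj_v //= inordK ?lt_j.
- by rewrite fv fS // (adj_sym y) adj_v //= inordK ?lt_j.
rewrite !fS // /= /rK_adj /= !inord_eq ?lt_i ?lt_j //.
have [yB yr] := rootP y yv; have [zB zr] := rootP z zv.
apply/andP/idP => [[/eqP/(i_inj _ _ yv zv) yz jyz]|yz].
  rewrite yz // in yr yB; apply: (branch_clique zB (dw _ zB) yr zr).
  by apply: contra jyz => /eqP->.
have root_yz : root y = root z.
  symmetry; apply: root_eq => //; move: yr; rewrite !inE => yr.
  apply: connect_trans yr _; apply: connect1; apply/and3P; split=> //; by rewrite inB.
rewrite /i root_yz eqxx; split=> //; apply: contraTneq yz => /j_inj -> //.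
by rewrite adj_irr.
Qed.

End Branches.

(** * Colors needed by a spider *)

Section SpiderColors.

Variables r t : nat.

Lemma spider_leg (i : 'I_r) (x : 'I_t) (s : seq (S_graph r t)) :
    path (@adj (S_graph r t)) (Some (i, x)) s -> None \notin s ->
  {in s, forall y, exists x', y = Some (i, x')}.
Proof.
elim: s x => // -[[i' x']|] s IHs x //= /andP[/andP[/= /eqP <- _] sP].
rewrite in_cons /= => sN y; rewrite in_cons => /predU1P[->|]; first by exists x'.
exact: IHs sP sN y.
Qed.

(** The vertex [x0] of index 0 is the only door from a leg to the center. *)
Lemma spider_leg_start (i : 'I_r) (x x0 : 'I_t) (s : seq (S_graph r t)) :
    path (@adj (S_graph r t)) (Some (i, x)) s -> Some (i, x0) \notin s ->
    x0 = 0 :> nat -> x != x0 -> None \notin s.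
Proof.
move=> + + x00; elim: s x => // -[[i' x']|] s IHs x /=; last first.
  by rewrite -x00 => /andP[/= /eqP/ord_inj->]; rewrite eqxx.
case/andP=> /andP[/= /eqP <- _] sP; rewrite in_cons negb_or => /andP[x'x0 sx0] _.
rewrite in_cons /=; apply: IHs sP sx0 _.
by apply: contraNneq x'x0 => ->.
Qed.

(** Legs are left and entered only through their roots. A simple path has used up its first root at
    the start, so it steps to the center at once; the root by which it then enters a leg must
    already be its end. *)
Lemma spider_path (i j : 'I_r) (x0 : 'I_t) (s : seq (S_graph r t)) :
    x0 = 0 :> nat -> i != j ->
    path (@adj (S_graph r t)) (Some (i, x0)) s -> uniq (Some (i, x0) :: s) ->
    last (Some (i, x0)) s = Some (j, x0) ->
  s = [:: None; Some (j, x0)].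
Proof.
move=> x00 ij; case: s => [|[[i' x]|] s] /=.
- by move=> _ _ [/eqP]; rewrite (negPf ij).
- case/andP=> /andP[/= /eqP <- x0x] sP /andP[]; rewrite in_cons negb_or => /andP[_ sx0] _.
  have sN := spider_leg_start sP sx0 x00; rewrite eq_sym x0x in sN.
  have leg := spider_leg sP (sN isT).
  have := mem_last (Some (i, x)) s; rewrite in_cons => /predU1P[->|/leg[x' ->]].
    by case=> /eqP; rewrite (negPf ij).
  by case=> /eqP; rewrite (negPf ij).
case: s => [_ _ //|[[l x]|] s] /=; last by rewrite andbF.
case/andP=> _ /andP[/= /eqP xE sP] /and3P[_ sN /andP[xs _]].
have {xE} def_x : x = x0 by apply/ord_inj; rewrite x00 -xE.
rewrite {x}def_x in sP sN xs *.
have leg := spider_leg sP; rewrite in_cons /= in sN.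
move=> last_s; have {leg} jl : j = l.
  have := mem_last (Some (l, x0)) s; rewrite last_s in_cons.
  by case/predU1P=> [|/(leg sN)[x']] [].
case: s {sP sN} xs last_s => [|y s] xs last_s; first by rewrite jl.
by have := mem_last y s; rewrite [last y s]last_s jl (negPf xs).
Qed.

Lemma spider_colors (G : sgraph) (k : nat) :
  0 < t -> isomorphic G (S_graph r t) -> proper_path_colorable G k -> r <= k.
Proof.
move=> t_gt0 [f [g fK gK] f_adj] /existsP[c /forallP cP].
pose x0 : 'I_t := Ordinal t_gt0; pose w i := g (Some (i, x0)).
suff col_inj : injective (fun i => c [set g None; w i]).
  by have := leq_card _ col_inj; rewrite !card_ord.
move=> i j /eqP; apply: contraTeq => ij.
have wij : w i != w j.
  by apply: contra ij => /eqP/(can_inj gK)[->].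
have /forallP/(_ (w j)) := cP (w i); rewrite wij /=.
case/proper_connectedP=> p /and3P[pP p_uniq pC] lastp.
have map_p : map f p = [:: None; Some (j, x0)].
  apply: (@spider_path i j x0) => //.
  - rewrite -[Some _]gK path_map; apply: sub_path pP => a b ab.
    by have := f_adj a b; rewrite ab.
  - by rewrite -[Some _]gK -map_cons map_inj_uniq //; apply: can_inj fK.
  by rewrite -[Some (i, _)]gK last_map lastp gK.
have def_p : p = [:: g None; w j].
  by rewrite -[p](mapK fK) map_p.
by move: pC; rewrite def_p /= andbT setUC.
Qed.

End SpiderColors.

(** * The upper bound and its case of equality *)

Section Bounds.

Variables (G : sgraph) (Gconn : connected G) (d : nat).
Hypotheses (degG : min_degree G = d) (d_ge2 : 2 <= d).

Let deg_ge (x : G) : d <= degree x.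
Proof. by rewrite -degG min_degree_le. Qed.

Lemma pc_colorable : proper_path_colorable G (pc Gconn).
Proof. by rewrite /pc; case: ex_minnP. Qed.

Lemma pc_min k : proper_path_colorable G k -> pc Gconn <= k.
Proof. by rewrite /pc; case: ex_minnP => m _ + /[dup] => /[apply]. Qed.

Lemma pc_le_outer k : 3 <= k ->
    (forall (B : {set G}) v, v \in B -> bridged B -> #|outer B| <= k) ->
  pc Gconn <= k.
Proof.
by case: k => [|[|[|k]]] // _ blocks; apply/pc_min/colorable_of_blocks.
Qed.

Lemma pc_le : pc Gconn <= maxn 3 ((#|G| - 1) %/ d.+1).
Proof.
apply: pc_le_outer => [|B v vB brB]; first exact: leq_maxl.
apply: leq_trans (leq_maxr _ _); rewrite leq_divRL //.
have := card_outer brB d_ge2 deg_ge.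
have : 0 < #|B| by apply/card_gt0P; exists v.
lia.
Qed.

(** If every bridged set had fewer than [pc Gconn] bridges, fewer colors would suffice. So some [B]
    has at least that many, and counting vertices forces equality and [#|B| = 1]. *)
Lemma spider_of_pc :
  3 < pc Gconn -> pc Gconn * d.+1 + 1 = #|G| -> isomorphic G (S_graph (pc Gconn) d.+1).
Proof.
case def_r: (pc Gconn) => [|r] // r_ge3 cardG.
have [B /and3P[brB B0 outB]|no_B] :=
    pickP [pred B : {set G} | [&& [forall q, ~~ second_edge B q], B != set0 & r < #|outer B|]].
  move/bridgedP: brB => brB; rewrite -card_gt0 in B0.
  have leG := card_outer brB d_ge2 deg_ge.
  have outr : #|outer B| = r.+1 by nia.
  have /eqP/cards1P[v Bv] : #|B| = 1 by rewrite outr in leG; lia.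
  exact (spider_of_branches Gconn brB d_ge2 deg_ge Bv outr cardG).
suff : pc Gconn <= r by rewrite def_r ltnn.
apply: pc_le_outer => // B v vB brB; have /= := no_B B.
have -> : B != set0 by apply/set0Pn; exists v.
by move/bridgedP: (brB) => -> /= /negbT; rewrite -leqNgt.
Qed.

End Bounds.

(** * Transfer to rational numbers *)

Import Order.TTheory GRing.Theory Num.Theory.
Local Open Scope ring_scope.

Theorem corollary3p7 (G : sgraph) (Gconn : connected G) (n delta : nat)
    (cardG : #|G| = n) (degG : min_degree G = delta) (delta_ge2 : (2 <= delta)%N) :
  (pc Gconn)%:R <= Num.max 3 ((n%:R - 1) / (delta%:R + 1)) :> rat
  /\ (3 < (n%:R - 1) / (delta%:R + 1) :> rat ->
      (delta * (delta + 1) + 1 <= n)%N ->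
      ((pc Gconn)%:R = (n%:R - 1) / (delta%:R + 1) :> rat
       <-> exists r t : nat,
             [/\ (0 < r)%N, (0 < t)%N, (t - 1 = delta)%N, (r * t + 1 = n)%N
               & isomorphic G (S_graph r t)])).
Proof.
(* On the graph without vertices the default value makes [min_degree] zero. Positivity of [n] keeps
   the natural subtraction [n - 1] from truncating. *)
have n_gt0 : (0 < n)%N.
  rewrite -cardG lt0n; apply: contraTneq delta_ge2 => /card0_eq G0.
  have noG (x : G) : False by have := G0 x; rewrite inE.
  rewrite -degG /min_degree big_pred0 => [|x]; last by case: (noG x).
  by rewrite (eq_card0 G0).
have -> : n%:R - 1 = (n - 1)%:R :> rat by rewrite natrB.
have -> : delta%:R + 1 = delta.+1%:R :> rat by rewrite natr1.
have d_gt0 : 0 < delta.+1%:R :> rat by rewrite ltr0n.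
have d_neq0 : delta.+1%:R != 0 :> rat by rewrite gt_eqF.
(* Clearing the denominator turns equality with the ratio into an exact product of naturals,
   divisibility included. *)
have ratioE m : (m%:R == (n - 1)%:R / delta.+1%:R :> rat) = (m * delta.+1 == n - 1)%N.
  by rewrite -(inj_eq (mulIf d_neq0)) divfK // -natrM eqr_nat.
have pc_max : (pc Gconn)%:R <= Num.max 3 ((n - 1)%:R / delta.+1%:R) :> rat.
  have := pc_le Gconn degG delta_ge2; rewrite cardG leq_max le_max.
  case/orP=> le_pc; first by rewrite ler_nat le_pc.
  by apply/orP; right; rewrite ler_pdivlMr // -natrM ler_nat -leq_divRL.
split=> // gt3 _; split=> [/eqP|[r [t [r_gt0 t_gt0 def_t rt iso]]]].
  rewrite ratioE => /eqP pcE; exists (pc Gconn), delta.+1.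
  have pc_gt3 : (3 < pc Gconn)%N.
    by move: gt3; rewrite -pcE natrM mulfK // ltr_nat.
  split; rewrite ?subn1 //; [exact: ltn_trans pc_gt3 | lia |].
  by apply: (spider_of_pc degG delta_ge2) => //; rewrite cardG; lia.
have def_r : r%:R = (n - 1)%:R / delta.+1%:R :> rat.
  by apply/eqP; rewrite ratioE; apply/eqP; rewrite -rt -def_t; nia.
(* The bridges at the center give [r] as a lower bound; the upper bound is [pc_max], whose maximum
   is the ratio by [gt3]. *)
apply/eqP; rewrite eq_le -def_r !ler_nat (spider_colors t_gt0 iso (pc_colorable Gconn)) andbT.
by rewrite -def_r in gt3 pc_max; rewrite (max_r (ltW gt3)) ler_nat in pc_max.
Qed.
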